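(* Let $H=(V,E)$ be a connected hypergraph with $|V|\ge 2$ and let $\Omega(H)$ be its multi-tree family. Assume that the optimal density $\tilde\eta^*$ of $\operatorname{Mod}_2(\widehat\Omega(H))$ is not a constant vector, and let $E_{max}$ be the set of hyperedges $e$ at which $\tilde\eta^*(e)$ attains the maximum value of $\tilde\eta^*$. Let $H/(E-E_{max})$ be the hypergraph obtained from $H$ by contracting $E-E_{max}$. Let $L_1,\dots,L_k$, with $L_i=(V_i,C_i)$, be the connected components of the hypergraph $H[E-E_{max}]$. Then: (i) $$\operatorname{Mod}_2(\widehat\Omega(H))=\operatorname{Mod}_2(\widehat\Omega(L_1))+\dots+\operatorname{Mod}_2(\widehat\Omega(L_k))+\operatorname{Mod}_2(\widehat\Omega(H/(E-E_{max}))).$$ (ii) The restriction of $\tilde\eta^*$ to $C_i$ is optimal for $\operatorname{Mod}_2(\widehat\Omega(L_i))$ for $i=1,\dots,k$, and the restriction of $\tilde\eta^*$ to $E_{max}$ is optimal for $\operatorname{Mod}_2(\widehat\Omega(H/(E-E_{max})))$.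
   Context: A hypergraph $H=(V,E)$ has a finite nonempty vertex set $V$ and a finite collection $E$ of subsets of $V$ (hyperedges), where repetitions are allowed (parallel hyperedges are distinct elements of $E$) and every hyperedge has at least two vertices. A hypergraph is connected if for every nonempty proper subset $X$ of its vertex set some hyperedge intersects both $X$ and its complement. For a subset or multiset $A$ from $E$, $H[A]$ is the hypergraph with vertex set $\bigcup_{e\in A}e$ and hyperedges the members of $A$ (copies being parallel hyperedges). For a hyperedge $f$, $H/f$ is obtained by merging the vertices of $f$ into one new vertex (in every hyperedge $e\ne f$ meeting $f$, replace $e\cap f$ by the new vertex) and removing resulting loops; $H/F$ is obtained by contracting all hyperedges of $F$. Hyperedges of $H/F$ are identified with the hyperedges of $H$ they come from (in particular the hyperedges of $H/(E-E_{max})$ are identified with elements of $E_{max}$). A set (or multiset) $F$ of hyperedges is a hyperforest if for every nonempty $X\subseteq V$ at most $|X|-1$ members of $F$ (counted with multiplicity) are contained in $X$; a hypertree is a hyperforest with $|F|=|V|-1$. For a multiset $A$ from $E$, $x^A\in\mathbb{R}^E_{\ge0}$ has $x^A(e)$ equal to the multiplicity of $e$ in $A$. The multi-tree family $\Omega(H)$ is the set of all $x^A$ such that $H[A]$ is a hypertree with vertex set $V$. For a family $\Gamma\subset\mathbb{R}^E_{\ge0}$, $\operatorname{Adm}(\Gamma)=\{\rho\in\mathbb{R}^E_{\ge0}:\gamma^T\rho\ge1\ \forall\gamma\in\Gamma\}$; the Fulkerson blocker family $\widehat\Gamma$ is the set of extreme points of $\operatorname{Adm}(\Gamma)$; $\operatorname{Mod}_2(\Gamma)=\inf_{\rho\in\operatorname{Adm}(\Gamma)}\sum_{e\in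 E}\rho(e)^2$, and its optimal density is the unique minimizer. *)

(* Defs.v *)
From HB Require Import structures.
From mathcomp Require Import all_boot all_order all_algebra.
From mathcomp Require Import all_classical all_reals ereal.
Set Implicit Arguments.
Unset Strict Implicit.
Unset Printing Implicit Defensive.
Import Order.TTheory GRing.Theory Num.Theory.
Local Open Scope ring_scope.

(* Hyperedges are abstract labels with an incidence map, so that parallel
   hyperedges are distinct.  Nonemptiness of the vertex set is not a field:
   this keeps H[A] total (H[A] has no vertex when A is empty). *)
Record hypergraph := Hypergraph {
  vert : finType;
  edge : finType;
  inc : edge -> {set vert};
  inc_gt1 : forall e, (1 < #|inc e|)%N }.

Definition hconnected (H : hypergraph) : bool :=
  [forall X : {set vert H}, (X != finset.set0) && (X != [set: vert H]%SET) ==>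
    [exists e : edge H,
      (inc e :&: X != finset.set0) && (inc e :&: ~: X != finset.set0)]].

Section Sub.
Variables (H : hypergraph) (X : {set vert H}) (A : {set edge H}).

Definition sub_vert := {v : vert H | v \in X}.
Definition sub_edge := {e : edge H | (e \in A) && (inc e \subset X)}.
Definition sub_inc (e : sub_edge) : {set sub_vert} :=
  [set v : sub_vert | val v \in inc (val e)]%SET.

Lemma sub_inc_gt1 (e : sub_edge) : (1 < #|sub_inc e|)%N.
Proof.
have /andP[_ eX] := valP e.
suff -> : #|sub_inc e| = #|inc (val e)| by exact: inc_gt1.
rewrite -(card_imset _ val_inj); apply: eq_card => v.
apply/imsetP/idP => [[w + ->]|ve]; first by rewrite inE.
by exists (exist _ v (fintype.subsetP eX v ve)); rewrite ?inE.
Qed.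

(* Vertex set X, hyperedges the members of A contained in X. *)
Definition subhyper : hypergraph := Hypergraph sub_inc_gt1.

Definition subhyper_edge (e : edge subhyper) : edge H := val (e : sub_edge).

End Sub.

(* H[A]; every member of A is contained in the union of A, so the
   hyperedges are all of A. *)
Definition induced (H : hypergraph) (A : {set edge H}) : hypergraph :=
  subhyper (\bigcup_(e in A) inc e)%SET A.

Definition induced_edge (H : hypergraph) (A : {set edge H}) :
  edge (induced A) -> edge H := @subhyper_edge H _ A.

(* The connected component of H on the vertex set X. *)
Definition component (H : hypergraph) (X : {set vert H}) : hypergraph :=
  subhyper X [set: edge H]%SET.

Definition component_edge (H : hypergraph) (X : {set vert H}) :
  edge (component X) -> edge H := @subhyper_edge H X _.

Definition components (H : hypergraph) : {set {set vert H}} :=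
  [set X | maxset [pred Y : {set vert H} |
             (Y != finset.set0) && hconnected (component Y)] X]%SET.

Section Contract.
Variables (H : hypergraph) (F : {set edge H}).

Definition share_edge : rel (vert H) :=
  [rel u v | [exists e in F, (u \in inc e) && (v \in inc e)]].

(* The vertices of H/F are the classes of the equivalence generated by
   merging the vertices of each member of F. *)
Definition merged_classes : {set {set vert H}} :=
  equivalence_partition (connect share_edge) [set: vert H]%SET.

Definition contract_vert := {B : {set vert H} | B \in merged_classes}.
Definition image_edge (e : edge H) : {set contract_vert} :=
  [set B : contract_vert | val B :&: inc e != finset.set0]%SET.

(* Members of F become loops; so may other hyperedges, which are removed. *)
Definition contract_edges : {set edge H} :=
  [set e | (e \notin F) && (1 < #|image_edge e|)%N]%SET.
Definition contract_edge := {e : edge H | e \in contract_edges}.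
Definition contract_inc (e : contract_edge) : {set contract_vert} :=
  image_edge (val e).

Lemma contract_inc_gt1 (e : contract_edge) : (1 < #|contract_inc e|)%N.
Proof. by have := valP e; rewrite inE => /andP[]. Qed.

Definition contraction : hypergraph := Hypergraph contract_inc_gt1.

Definition contracted_edge (e : edge contraction) : edge H :=
  val (e : contract_edge).

End Contract.

(* A multiset of hyperedges is given by its multiplicity function. *)
Section Hypertrees.
Variables (H : hypergraph) (m : {ffun edge H -> nat}).

Definition hyperforest : bool :=
  [forall X : {set vert H}, (X != finset.set0) ==>
    (\sum_(e : edge H | inc e \subset X) m e <= #|X|.-1)%N].

Definition hypertree : bool :=
  hyperforest && (\sum_(e : edge H) m e == #|vert H|.-1)%N.

(* H[m] is a hypertree with vertex set V. *)
Definition multitree : bool :=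
  ((\bigcup_(e : edge H | (0 < m e)%N) inc e)%SET == [set: vert H]%SET)
    && hypertree.

End Hypertrees.

Section Modulus.
Variables (R : realType) (E : finType).
Implicit Types (G : set (E -> R)) (rho : E -> R).

Definition Adm G : set (E -> R) :=
  [set rho | (forall e, 0 <= rho e) /\
             (forall gamma, G gamma -> 1 <= \sum_(e : E) gamma e * rho e)]%classic.

Definition extreme_points G : set (E -> R) :=
  [set x | G x /\ forall (y z : E -> R) (t : R), G y -> G z -> 0 < t < 1 ->
           x = (fun e => t * y e + (1 - t) * z e) -> y = z]%classic.

Definition blocker G : set (E -> R) := extreme_points (Adm G).

Definition energy rho : R := \sum_(e : E) rho e ^+ 2.

(* Equal to +oo when no density is admissible. *)
Definition Mod2 G : \bar R :=
  ereal_inf [set (energy rho)%:E | rho in Adm G]%classic.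

(* Such a rho is unique: Adm G is convex and the energy strictly convex. *)
Definition optimal_density G rho : Prop :=
  Adm G rho /\ (energy rho)%:E = Mod2 G.

Definition maximizers rho : {set E} :=
  [set e | [forall f, rho f <= rho e]]%SET.

End Modulus.

Definition Omega (R : realType) (H : hypergraph) : set (edge H -> R) :=
  [set (fun e => (m e)%:R) | m in [set m | multitree m]]%classic.

Arguments Omega : clear implicits.

(* Main.v *)
Require Import Defs.
From HB Require Import structures.
From mathcomp Require Import all_boot all_order all_algebra.
From mathcomp Require Import all_classical all_reals ereal.
From mathcomp Require Import zify ring lra.
Set Implicit Arguments.
Unset Strict Implicit.
Unset Printing Implicit Defensive.
Import Order.TTheory GRing.Theory Num.Theory.
Local Open Scope ring_scope.

(** Blocking duality identifies the densities admissible for the blocker of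
    [Omega H] with the [zeta >= 0] satisfying [zeta (cut g) >= |g(V)| - 1] for
    every vertex coloring [g], where [cut g] is the set of hyperedges that are
    not monochromatic; partitions of the vertex set appear as colorings.  One
    inclusion tests [zeta] on the density constant on [cut g] (an admissible
    density can be replaced by an extreme point of no larger cost), the other
    compares [zeta] with a greedy hypertree, level by level.

    If [eta] is the point of minimal norm, then [eta . m >= eta . eta] for the
    greedy hypertree [m] of the weight [eta], while level by level [eta]
    dominates [m].  Hence [eta] and [m] have the same mass on every level set:
    each [{eta >= t}] is the cut of a coloring [g] with
    [eta (cut g) = |g(V)| - 1].  In particular this holds for [E_max].  Feasibility
    and optimality of the restrictions of [eta] then follow by testing [eta] on
    colorings glued from a coloring of a component and a coloring whose cut is
    a level set; on [E_max] the density [eta] is constant. *)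

(** * Tight sets and greedy hypertrees *)

Definition cut (H : hypergraph) (T : finType) (g : vert H -> T) : {set edge H} :=
  [set e | [exists u in inc e, [exists v in inc e, g u != g v]]]%SET.

Lemma notin_cutP (H : hypergraph) (T : finType) (g : vert H -> T) e :
  reflect {in inc e &, forall u v, g u = g v} (e \notin cut g).
Proof.
rewrite inE; apply: (iffP idP) => [|gc].
  rewrite negb_exists => /forallP ge u v ue ve; apply/eqP.
  have := ge u; rewrite ue negb_exists => /forallP/(_ v).
  by rewrite ve /= negbK.
apply/negP => /exists_inP[u ue /exists_inP[v ve]].
by rewrite (gc u v) ?eqxx.
Qed.

Lemma inc_neq0 (H : hypergraph) (e : edge H) : exists v, v \in inc e.
Proof.
by apply/card_gt0P; apply: leq_trans (inc_gt1 e).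
Qed.

Section Forest.
Variable H : hypergraph.
Implicit Types (m : {ffun edge H -> nat}) (X Y : {set vert H}).
Local Open Scope nat_scope.

Definition inner m X : nat := \sum_(e | inc e \subset X) m e.

(** The strict inequality replaces the truncated predecessor [#|X|.-1], which is harmless because
    [X] is nonempty. *)
Lemma hyperforestP m :
  reflect (forall X, X != finset.set0 -> inner m X < #|X|) (hyperforest m).
Proof.
apply: (iffP forallP) => [f X X0|f X].
  by have := f X; move: X0; rewrite -card_gt0 => X0; rewrite X0 /inner /=; lia.
by apply/implyP => X0; have := f X X0; rewrite /inner; lia.
Qed.

(** For a hyperforest this is equality [inner m X = |X| - 1]; the other inequality is the forest
    condition. *)
Definition tight m X := (X != finset.set0) && (#|X| <= (inner m X).+1).

(** Uncrossing: [inner m] is supermodular while cardinality is modular, and the forest bound applies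
    to the nonempty [X :&: Y]. *)
Lemma tightU m X Y : hyperforest m -> tight m X -> tight m Y ->
  X :&: Y != finset.set0 -> tight m (X :|: Y).
Proof.
move=> /hyperforestP f /andP[X0 tX] /andP[Y0 tY] XY0.
have XY := f _ XY0; have cXY := cardsUI X Y.
apply/andP; split.
  by apply: contra_neq X0 => XYe; apply/eqP; rewrite -finset.subset0 -XYe finset.subsetUl.
suff : inner m X + inner m Y <= inner m (X :|: Y) + inner m (X :&: Y) by lia.
rewrite /inner !(big_mkcond (fun e => inc e \subset _)) -!big_split /=.
apply: leq_sum => e _; rewrite finset.subsetI.
case eX: (inc e \subset X); case eY: (inc e \subset Y) => //=.
- by rewrite (fintype.subset_trans eX) ?finset.subsetUl.
- by rewrite (fintype.subset_trans eX) ?finset.subsetUl //; lia.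
- by rewrite (fintype.subset_trans eY) ?finset.subsetUr //; lia.
Qed.

Lemma tight1 m v : tight m [set v]%SET.
Proof. by rewrite /tight cards1 -card_gt0 cards1. Qed.

(** Singletons are tight, so the maximum exists; for a hyperforest, uncrossing makes this the
    largest tight set through [v] for inclusion as well. *)
Definition tight_hull m v : {set vert H} :=
  [arg max_(X > [set v]%SET | tight m X && (v \in X)) #|X|].

Lemma tight_hullP m v : tight m (tight_hull m v) /\ v \in tight_hull m v.
Proof.
rewrite /tight_hull; case: arg_maxnP; first by rewrite tight1 inE /=.
by move=> X /andP[].
Qed.

Lemma tight_hull_max m v X : hyperforest m -> tight m X -> v \in X ->
  X \subset tight_hull m v.
Proof.
move=> f tX vX; rewrite /tight_hull; case: arg_maxnP; first by rewrite tight1 inE /=.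
move=> Y /andP[tY vY] mY.
have tXY : tight m (X :|: Y).
  by apply: tightU => //; apply/finset.set0Pn; exists v; rewrite inE vX.
have /mY le : tight m (X :|: Y) && (v \in X :|: Y) by rewrite tXY inE vX.
have /eqP -> : Y == X :|: Y by rewrite eqEcard finset.subsetUr.
exact: finset.subsetUl.
Qed.

Lemma tight_hull_eq m v w : hyperforest m -> w \in tight_hull m v ->
  tight_hull m w = tight_hull m v.
Proof.
move=> f wv; have [tv vv] := tight_hullP m v; have [tw ww] := tight_hullP m w.
have vw : tight_hull m v \subset tight_hull m w by exact: tight_hull_max.
apply/eqP; rewrite finset.eqEsubset vw andbT; apply: tight_hull_max => //.
exact: (fintype.subsetP vw).
Qed.

Lemma card_fibers (T : finType) (g : vert H -> T) :
  \sum_(x in g @: [set: vert H]%SET) #|(g @^-1: [set x])%SET| = #|vert H|.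
Proof.
rewrite -[RHS]sum1_card (partition_big g (fun x => x \in g @: [set: vert H]%SET)) /=.
  apply: eq_bigr => x _; rewrite -sum1_card; apply: eq_bigl => v.
  by rewrite !inE.
by move=> v _; rewrite imset_f ?inE.
Qed.

(* The tight hulls partition the vertices, so [tight_hull m] is a coloring
   that is constant on every hyperedge contained in a tight set. *)
Lemma tight_hull_sum m : hyperforest m ->
  #|vert H| <= \sum_e m e + #|tight_hull m @: [set: vert H]%SET|.
Proof.
move=> f; rewrite -(card_fibers (tight_hull m)) -[X in _ + X]sum1_card.
have fib X : X \in tight_hull m @: [set: vert H]%SET ->
    (tight_hull m @^-1: [set X])%SET = X /\ tight m X.
  move=> /imsetP[v _ ->]; have [tv vv] := tight_hullP m v; split=> //.
  apply/finset.setP => w; rewrite !inE; apply/eqP/idP => [<-|]; last exact: tight_hull_eq.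
  by have [] := tight_hullP m w.
apply: (@leq_trans (\sum_(X in tight_hull m @: [set: vert H]%SET) (inner m X + 1))).
  by apply: leq_sum => X /fib[-> /andP[_]]; rewrite addn1.
rewrite big_split leq_add2r /inner (exchange_big_dep predT) //=.
apply: leq_sum => e _.
have [v ve] := inc_neq0 e.
rewrite -[X in _ <= X](@big_pred1_eq _ 0 addn _ (tight_hull m v) (fun=> m e)).
rewrite [X in X <= _]big_mkcond [X in _ <= X]big_mkcond; apply: leq_sum => X _.
case: andP => // -[/imsetP[w _ ->] /fintype.subsetP/(_ v ve) vw].
by rewrite (tight_hull_eq f vw) eqxx.
Qed.

Lemma hyperforest_le m m' : (forall e, m e <= m' e) -> hyperforest m' -> hyperforest m.
Proof.
move=> le /hyperforestP f; apply/hyperforestP => X /f; apply: leq_ltn_trans.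
exact: leq_sum.
Qed.

(** Copies of [e] are added as long as the forest condition survives. One more copy violates it on
    some [X]; this [X] contains [e] and is tight for the last valid multiplicity. *)
Lemma hyperforest_augment m e : hyperforest m -> exists m',
  [/\ hyperforest m', forall f, m f <= m' f, forall f, f != e -> m' f = m f
    & exists2 X : {set vert H}, inc e \subset X & tight m' X].
Proof.
move=> fm.
pose mm c : {ffun edge H -> nat} := [ffun f => m f + (f == e) * c].
have ex0 : exists c, hyperforest (mm c).
  by exists 0; apply: hyperforest_le fm => f; rewrite ffunE muln0 addn0.
have bnd c : hyperforest (mm c) -> c <= #|vert H|.
  move=> /hyperforestP/(_ (inc e)); rewrite -card_gt0 (ltnW (inc_gt1 e)).
  move=> /(_ isT); rewrite /inner (bigD1 e) //= ffunE eqxx mul1n.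
  move=> /ltnW le; apply: leq_trans (max_card (inc e)); apply: leq_trans le.
  by rewrite -addnA addnCA leq_addr.
case: (ex_maxnP ex0 bnd) => c fc maxc.
exists (mm c); split=> // [f|f /negPf fe|]; rewrite ?ffunE ?leq_addr ?fe ?addn0 //.
have : ~~ hyperforest (mm c.+1) by apply: contraT; rewrite negbK => /maxc; rewrite ltnn.
rewrite negb_forall => /existsP[X]; rewrite negb_imply => /andP[X0 lt].
have lt' : #|X| <= inner (mm c.+1) X.
  by move: lt X0; rewrite -card_gt0 /inner; lia.
have := hyperforestP _ fc X X0 => cX.
have eqi : inner (mm c.+1) X = inner (mm c) X + (inc e \subset X).
  rewrite /inner; case eX: (inc e \subset X).
    have E : \sum_(f | (inc f \subset X) && (f != e)) mm c.+1 f =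
             \sum_(f | (inc f \subset X) && (f != e)) mm c f.
      by apply: eq_bigr => f /andP[_ /negPf fe]; rewrite !ffunE fe.
    by rewrite !(bigD1 e eX) /= E !ffunE eqxx !mul1n addn1 addnS addSn.
  rewrite addn0; apply: eq_bigr => f fX; rewrite !ffunE.
  by case: eqVneq fX => // ->; rewrite eX.
exists X; last by rewrite /tight X0; move: eqi; case: (_ \subset _); lia.
by apply/negPn/negP => /negPf eX; move: eqi; rewrite eX; lia.
Qed.

End Forest.

(** * Connectivity in terms of sets and colorings that split no hyperedge *)

Lemma hconnectedP (H : hypergraph) :
  reflect (forall S : {set vert H},
      (forall e, (inc e \subset S) || (inc e \subset ~: S)%SET) ->
      S = finset.set0 \/ S = [set: vert H]%SET)
    (hconnected H).
Proof.
have sub0 (A B : {set vert H}) : (A :&: B == finset.set0) = (A \subset ~: B)%SET.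
  by rewrite finset.setI_eq0 finset.disjoints_subset.
apply: (iffP forallP) => [conn S inS|conn S].
  case: (eqVneq S finset.set0) => [->|S0]; first by left.
  case: (eqVneq S [set: vert H]%SET) => [->|S1]; first by right.
  have := conn S; rewrite S0 S1 => /existsP[e].
  by rewrite !sub0 finset.setCK -negb_or orbC inS.
apply/implyP => /andP[S0 S1]; apply: contraT => /existsPn noe.
have inS e : (inc e \subset S) || (inc e \subset ~: S)%SET.
  by have := noe e; rewrite !sub0 finset.setCK -negb_or negbK orbC.
by have [E|E] := conn S inS; [rewrite E eqxx in S0|rewrite E eqxx in S1].
Qed.

Lemma connected_coloring (H : hypergraph) (T : finType) (g : vert H -> T) :
  hconnected H -> (forall e, e \notin cut g) -> forall u v, g u = g v.
Proof.
move=> /hconnectedP conn ncut u v.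
have [e|S0|ST] := conn [set w | g w == g u]%SET.
- have [w we] := inc_neq0 e; have /notin_cutP gc := ncut e.
  case: (eqVneq (g w) (g u)) => guw; apply/orP; [left|right];
    by apply/fintype.subsetP => x xe; rewrite !inE (gc x w xe we) ?guw ?eqxx.
- by have := finset.in_set0 u; rewrite -S0 inE eqxx.
- by have := finset.in_setT v; rewrite -ST inE => /eqP.
Qed.

Section Greedy.
Variables (R : realType) (H : hypergraph) (rho : edge H -> R).
Implicit Types (m : {ffun edge H -> nat}) (X : {set vert H}).

Definition below m (t : R) : {ffun edge H -> nat} :=
  [ffun e => if rho e < t then m e else 0%N].

(* Hyperedges are added by increasing weight, each with the largest
   multiplicity that keeps a hyperforest. *)
Lemma greedy_forest (A : {set edge H}) : exists m,
  [/\ hyperforest m, forall e, e \notin A -> m e = 0%N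
    & forall t e, e \in A -> rho e < t ->
        exists2 X : {set vert H}, inc e \subset X & tight (below m t) X].
Proof.
move: {2}#|A| (leqnn #|A|) => n; elim: n A => [|n IH] A.
  rewrite leqn0 cards_eq0 => /eqP ->; exists [ffun=> 0%N]; split=> [|e _|t e]; rewrite ?inE ?ffunE //.
  apply/hyperforestP => X X0; rewrite /inner big1 ?card_gt0 // => e _.
  by rewrite ffunE.
case: (finset.set_0Vmem A) => [->|[e0 e0A] An].
  by move=> _; apply: IH; rewrite cards0.
(* A heaviest hyperedge comes last: any [t] above its weight is above all weights in [A], so
   [below m' t] is all of [m']. *)
have [e eA emax] : exists2 e, e \in A & forall f, f \in A -> rho f <= rho e.
  by case: (arg_maxP rho e0A) => e eA emax; exists e.
have [|m [fm m0 mt]] := IH (A :\ e)%SET.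
  by have := cardsD1 e A; rewrite eA; lia.
have [m' [fm' le_m m_eq [Y eY tY]]] := hyperforest_augment e fm.
have m'0 f : f \notin A -> m' f = 0%N.
  move=> fA; rewrite m_eq ?m0 ?inE ?(negPf fA) ?andbF //.
  by apply: contraNneq fA => ->.
exists m'; split=> // t f fA ft.
case: (eqVneq f e) => [fe|fe].
  subst f; exists Y => //; rewrite /tight /inner in tY *.
  suff E : below m' t = m' by rewrite E.
  apply/ffunP => f; rewrite ffunE; case: ifPn => // ntf; rewrite m'0 //.
  by apply: contra ntf => /emax/le_lt_trans; apply.
have [|X fX /andP[X0 tX]] := mt t f _ ft; first by rewrite !inE fe.
exists X => //; rewrite /tight X0 (leq_trans tX) // ltnS; apply: leq_sum => h _.
by rewrite !ffunE; case: ifP.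
Qed.

(** At level [t], color by the tight hulls of [below m t]. Lighter hyperedges lie in tight sets and
    are monochromatic, and [tight_hull_sum] bounds what remains of the total [|V| - 1]. *)
Lemma greedy_tree : hconnected H -> (1 < #|vert H|)%N -> exists2 m, multitree m &
  forall t, exists g : vert H -> {set vert H},
    {in cut g, forall e, t <= rho e} /\
    (\sum_(e | (t <= rho e)%R) m e < #|g @: [set: vert H]%SET|)%N.
Proof.
move=> conn V1; have [m [fm _ mt]] := greedy_forest [set: edge H]%SET.
have below_f t : hyperforest (below m t).
  by apply: hyperforest_le fm => e; rewrite ffunE; case: ifP.
have hull_const t e : rho e < t -> e \notin cut (tight_hull (below m t)).
  move=> et; have [X eX tX] := mt t e (finset.in_setT e) et.
  apply/notin_cutP => u v ue ve; apply/esym/tight_hull_eq => //.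
  by apply: (fintype.subsetP (tight_hull_max _ tX _)) => //; apply: (fintype.subsetP eX).
have sum_m : (\sum_e m e)%N = #|vert H|.-1.
  have [u _] : exists u, u \in vert H by apply/card_gt0P/ltnW.
  (* [T] exceeds every weight, so all hyperedges are monochromatic at this level and connectivity
     leaves a single color. *)
  pose T := 1 + \sum_e `|rho e|.
  have ltT e : rho e < T.
    rewrite /T (bigD1 e) //= ltr_pwDl // ler_wpDr ?ler_norm //.
    exact: sumr_ge0.
  have E : below m T = m by apply/ffunP => e; rewrite ffunE ltT.
  have := tight_hull_sum fm; rewrite -{2}E.
  have -> : #|tight_hull (below m T) @: [set: vert H]%SET| = 1%N.
    apply/eqP/cards1P; exists (tight_hull (below m T) u); apply/finset.setP => X.
    rewrite inE; apply/imsetP/eqP => [[v _ ->]|->]; last by exists u.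
    by apply: connected_coloring => // e; exact: hull_const.
  have := hyperforestP _ fm [set: vert H]%SET.
  rewrite -card_gt0 cardsT (ltnW V1) => /(_ isT).
  have -> : inner m [set: vert H]%SET = (\sum_e m e)%N.
    by apply: eq_bigl => e; rewrite finset.subsetT.
  by move: (\sum_e m e)%N #|vert H|; lia.
exists m.
  apply/andP; split; last by rewrite /hypertree fm sum_m eqxx.
  apply/eqP/finset.setP => v; rewrite [in RHS]inE; apply: contraT => nv.
  (* If [m] missed [v], all [|V| - 1] members would lie in the complement of [v], where the forest
     condition allows [|V| - 2]. *)
  have := hyperforestP _ fm (~: [set v])%SET.
  have cv : #|(~: [set v])%SET| = #|vert H|.-1 by rewrite cardsC1.
  rewrite -card_gt0 cv -sum_m sum_m -ltnS prednK ?(ltnW V1) // V1 => /(_ isT).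
  suff -> : inner m (~: [set v])%SET = (\sum_e m e)%N by rewrite sum_m; lia.
  rewrite /inner big_mkcond; apply: eq_bigr => e _.
  rewrite finset.subsetC finset.sub1set inE; case: ifPn => //; rewrite negbK => ve.
  case: (posnP (m e)) => // me; case/negP: nv.
  by apply/finset.bigcupP; exists e.
move=> t; exists (tight_hull (below m t)); split=> [e ec|].
  by rewrite leNgt; apply: contraL ec; exact: hull_const.
have := tight_hull_sum (below_f t).
have : (\sum_e m e = \sum_e below m t e + \sum_(e | (t <= rho e)%R) m e)%N.
  rewrite [X in (_ + X)%N]big_mkcond -big_split; apply: eq_bigr => e _ /=.
  by rewrite ffunE leNgt; case: ifP; rewrite /= ?addn0.
rewrite sum_m; move: V1.
move: (\sum_e below _ _ e)%N (\sum_(e | _) m e)%N #|vert H| #|_ @: _|; lia.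
Qed.

End Greedy.

(** * Level sets and extreme points *)

Section LinearProgramming.
Variables (R : realType) (E : finType).
Implicit Types (x y z d eta rho : E -> R).

Definition dot x y : R := \sum_e x e * y e.

Lemma dotC x y : dot x y = dot y x.
Proof. by apply: eq_bigr => e _; rewrite mulrC. Qed.

Lemma dot_combine x y z (a b : R) :
  dot x (fun e => a * y e + b * z e) = a * dot x y + b * dot x z.
Proof.
by rewrite /dot !mulr_sumr -big_split; apply: eq_bigr => e _ /=; ring.
Qed.

Lemma dot_ge0 x y : (forall e, 0 <= x e) -> (forall e, 0 <= y e) -> 0 <= dot x y.
Proof. by move=> x0 y0; apply: sumr_ge0 => e _; rewrite mulr_ge0. Qed.

(* Subtracting from [rho] its least positive value, on its support, removes
   one level; [dot d rho] is a positive combination of the level sums. *)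
Lemma dot_levels d rho : (forall e, 0 <= rho e) ->
  (forall t : R, 0 < t -> 0 <= \sum_(e | t <= rho e) d e) ->
  0 <= dot d rho /\
  (dot d rho = 0 -> forall t : R, 0 < t -> \sum_(e | t <= rho e) d e = 0).
Proof.
pose supp rho := [set e | 0 < rho e]%SET.
move: {2}#|supp rho| (leqnn #|supp rho|) => n; elim: n rho => [|n IH] rho.
  rewrite leqn0 cards_eq0 => /eqP s0 rho0 _.
  have r0 e : rho e = 0.
    by apply/eqP; rewrite eq_le rho0 andbT leNgt; have := finset.in_set0 e; rewrite -s0 inE => ->.
  rewrite /dot big1 => [|e _]; last by rewrite r0 mulr0.
  by split=> // _ t t0; rewrite big_pred0 // => e; rewrite r0 leNgt t0.
case: (finset.set_0Vmem (supp rho)) => [s0 _|[e0 e0s] sn] rho0 d0.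
  by apply: IH => //; rewrite s0 cards0.
have [e1 e1s emin] : exists2 e, e \in supp rho & forall f, f \in supp rho -> rho e <= rho f.
  by case: (arg_minP rho e0s) => e es emin; exists e.
set s := rho e1 in emin; have s0 : 0 < s by rewrite inE in e1s.
pose rho' e := if s <= rho e then rho e - s else rho e.
have ge_s e : (s <= rho e) = (0 < rho e).
  apply/idP/idP => [|e_pos]; first exact: lt_le_trans.
  by apply: emin; rewrite inE.
have rho'0 e : 0 <= rho' e.
  by rewrite /rho'; case: ifP => h; rewrite ?subr_ge0.
have lev t e : 0 < t -> (t <= rho' e) = (t + s <= rho e).
  move=> t0; rewrite /rho'; case: ifP => h; first by rewrite lerBrDr.
  move: h; rewrite ge_s lt_neqAle rho0 andbT => /negbFE/eqP <-.
  by rewrite !leNgt t0 addr_gt0.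
have decomp : dot d rho = dot d rho' + s * \sum_(e | s <= rho e) d e.
  rewrite /dot mulr_sumr [X in _ + X]big_mkcond -big_split; apply: eq_bigr => e _ /=.
  by rewrite /rho'; case: ifP => _; ring.
have [||| dr' z'] := IH rho'.
- have e1s' : e1 \in supp rho by [].
  have := sn; rewrite (cardsD1 e1) e1s' add1n ltnS; apply: leq_trans.
  apply/subset_leq_card/fintype.subsetP => e; rewrite !inE => e'0.
  have e_pos : 0 < rho e.
    by apply: lt_le_trans e'0 _; rewrite /rho'; case: ifP => // _; rewrite gerBl ltW.
  rewrite e_pos andbT; apply: contraTneq e'0 => ->.
  by rewrite /rho' lexx subrr ltxx.
- by [].
- move=> t t0; rewrite (eq_bigl (fun e => t + s <= rho e)); last by move=> e; rewrite lev.
  by apply: d0; rewrite addr_gt0.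
have ds := d0 s s0; split; first by rewrite decomp addr_ge0 // mulr_ge0 // ltW.
move/eqP; rewrite decomp paddr_eq0 // ?mulr_ge0 ?(ltW s0) // => /andP[/eqP dr'0].
rewrite mulf_eq0 gt_eqF //= => /eqP ds0 t t0; case: (leP t s) => ts.
  rewrite -[RHS]ds0; apply: eq_bigl => e; apply/idP/idP; last exact: le_trans.
  by move=> te; rewrite ge_s (lt_le_trans t0).
rewrite -[RHS](z' dr'0 (t - s)) ?subr_gt0 //.
by apply: eq_bigl => e; rewrite lev ?subr_gt0 // subrK.
Qed.

(* Among the admissible densities of cost at most [dot eta rho], one with the
   most active constraints is extreme: along a line of admissible densities
   through it on which the cost does not increase, a further constraint would
   become active. *)
Lemma blocker_dot_le (J : finType) (gam : J -> E -> R) eta rho :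
  let G := [set gam j | j in [set: J]%classic]%classic in
  (forall e, 0 <= eta e) -> Adm G rho ->
  exists2 rho', blocker G rho' & dot eta rho' <= dot eta rho.
Proof.
move=> G eta0 Arho.
(* All constraints are indexed together: nonnegativity on the left with bound 0, the family on the
   right with bound 1. *)
pose L (i : E + J) x := match i with inl e => x e | inr j => dot (gam j) x end.
pose b (i : E + J) : R := match i with inl _ => 0 | inr _ => 1 end.
have AdmE x : Adm G x <-> forall i, b i <= L i x.
  split=> [[x0 Gx] [e|j] /=|bL]; [exact: x0|by apply: Gx; exists j|].
  by split=> [e|_ [j _ <-]]; [exact: (bL (inl e))|exact: (bL (inr j))].
have LD i x y s t : L i (fun e => s * x e + t * y e) = s * L i x + t * L i y.
  by case: i => [e|j] //=; rewrite dot_combine.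
pose act x := [set i | L i x == b i]%SET.
pose P n := `[< exists x, [/\ Adm G x, dot eta x <= dot eta rho & #|act x| = n] >].
have exP : exists n, P n by exists #|act rho|; apply/asboolP; exists rho.
have bndP n : P n -> (n <= #|{: E + J}|)%N by move/asboolP => [x [_ _ <-]]; exact: max_card.
case: (ex_maxnP exP bndP) => n /asboolP[x [Ax xrho actx] maxn].
have bL := (AdmE x).1 Ax.
(* A direction that fixes the active constraints and does not raise the cost has no negative
   coordinate: following it as far as feasibility allows would give more active constraints than the
   maximum. *)
have stuck d : (forall i, i \in act x -> L i d = 0) -> dot eta d <= 0 ->
    (exists e, d e < 0) -> False.
  move=> dact deta [e de].
  pose neg i := L i d < 0.
  have ne : neg (inl e) by [].
  (* Ratio test: constraint [i] becomes active after the step length [step i] along [d]. *)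
  pose step i := (L i x - b i) / (- L i d).
  case: (arg_minP step ne) => i ni imin.
  set s := step i in imin.
  have s0 : 0 <= s by rewrite /s /step divr_ge0 ?subr_ge0 ?oppr_ge0 // ltW.
  pose x' e := 1 * x e + s * d e.
  have Ax' : Adm G x'.
    apply/AdmE => k; rewrite LD mul1r; case: (ltP (L k d) 0) => kd.
      have := imin k kd; rewrite /step ler_pdivlMr ?oppr_gt0 // => h.
      by rewrite -subr_ge0; move: h; lra.
    by rewrite (le_trans (bL k)) // lerDl mulr_ge0.
  have : (#|act x'| <= n)%N.
    apply: maxn; apply/asboolP; exists x'; split=> //.
    by rewrite dot_combine mul1r (le_trans _ xrho) // gerDl mulr_ge0_le0.
  rewrite leqNgt -actx => /negP; apply; apply: proper_card.
  apply/fintype.properP; split.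
    apply/fintype.subsetP => k kx; rewrite inE LD mul1r (dact k kx) mulr0 addr0.
    by rewrite inE in kx.
  exists i; last by apply/negP => /dact id0; move: ni; rewrite /neg id0 ltxx.
  rewrite inE LD mul1r /s /step -subr_eq0; apply/eqP.
  have : L i d != 0 by apply: ltr0_neq0.
  by move=> ?; field.
exists x => //; split=> // y z t Ay Az /andP[t0 t1] xE.
apply: contrapT => yz.
have [e de0] : exists e, y e != z e.
  apply: contrapT => nex; apply: yz; apply/funext => e; apply: contrapT => ne.
  by apply: nex; exists e; apply/eqP.
(* A constraint active at a proper convex combination of [y] and [z] is active at both, so it is
   constant along [y - z]. *)
have dact s i : i \in act x -> L i (fun e => s * y e + (- s) * z e) = 0.
  rewrite inE LD => /eqP; rewrite xE LD => Lb.
  have yb := (AdmE y).1 Ay i; have zb := (AdmE z).1 Az i.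
  have yE : L i y = b i by nra.
  have zE : L i z = b i by nra.
  by rewrite yE zE; ring.
have stuck2 s : s * (dot eta y - dot eta z) <= 0 ->
    (exists e, s * (y e - z e) < 0) -> False.
  move=> h [f hf]; apply: (stuck (fun e => s * y e + (- s) * z e)).
  - exact: dact.
  - by rewrite dot_combine; move: h; lra.
  - by exists f; move: hf; lra.
have dotB : dot eta y - dot eta z = dot eta (fun e => 1 * y e + (-1) * z e).
  by rewrite dot_combine; ring.
have sgn s : s * (dot eta y - dot eta z) <= 0 -> forall e, 0 <= s * (y e - z e).
  by move=> h f; rewrite leNgt; apply/negP => hf; apply: (stuck2 s) => //; exists f.
(* If [s (y - z)] has nonpositive cost, its coordinates are nonnegative by [sgn], so its cost is
   zero because [eta >= 0]. Then [-s] qualifies too, which forces [y e = z e]. *)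
have opp s : s != 0 -> s * (dot eta y - dot eta z) <= 0 -> False.
  move=> s0 h; have sg := sgn s h.
  have h' : (- s) * (dot eta y - dot eta z) <= 0.
    have : 0 <= dot eta (fun e => s * y e + (- s) * z e).
      by apply: dot_ge0 => // f; have := sg f; lra.
    by rewrite dot_combine; lra.
  have := sgn _ h' e; have := sg e => h1 h2.
  have : s * (y e - z e) = 0 by lra.
  by apply/eqP; rewrite mulf_neq0 ?subr_eq0.
case: (leP (dot eta y - dot eta z) 0) => h.
  by apply: (opp 1); rewrite ?oner_neq0 ?mul1r.
by apply: (opp (-1)); rewrite ?oppr_eq0 ?oner_neq0 // mulN1r oppr_le0 ltW.
Qed.

End LinearProgramming.

(** * Admissible densities and cuts *)

Section Optimality.
Variables (R : realType) (E : finType) (G : set (E -> R)).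

Lemma Mod2_le rho : Adm G rho -> (Mod2 G <= (energy rho)%:E)%E.
Proof. by move=> Arho; apply: ereal_inf_lbound; exists rho. Qed.

Lemma energy_dot (rho : E -> R) : energy rho = dot rho rho.
Proof. by apply: eq_bigr => e _; rewrite expr2. Qed.

Lemma energy_combine (x y : E -> R) (a b : R) :
  energy (fun e => a * x e + b * y e) =
  a ^+ 2 * energy x + a * b * dot x y *+ 2 + b ^+ 2 * energy y.
Proof.
rewrite /energy /dot !mulr_sumr -sumrMnl -!big_split; apply: eq_bigr => e _ /=; ring.
Qed.

Lemma energy_ge0 (rho : E -> R) : 0 <= energy rho.
Proof. by apply: sumr_ge0 => e _; rewrite sqr_ge0. Qed.

Lemma Adm_convex x y (s : R) : 0 <= s <= 1 -> Adm G x -> Adm G y ->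
  Adm G (fun e => (1 - s) * x e + s * y e).
Proof.
move=> /andP[s0 s1] [x0 Gx] [y0 Gy]; split=> [e|gam Ggam].
  by rewrite addr_ge0 // mulr_ge0 // subr_ge0.
have := Gx _ Ggam; have := Gy _ Ggam; rewrite -!/(dot _ _) dot_combine.
by nra.
Qed.

(** Variational inequality for the point of minimal norm in a convex set: no segment from [eta] to
    an admissible [zeta] may start by decreasing the energy. *)
Lemma optimal_densityP eta : optimal_density G eta <->
  Adm G eta /\ forall zeta, Adm G zeta -> energy eta <= dot eta zeta.
Proof.
split=> [[Aeta opt]|[Aeta opt]]; split=> //.
  move=> zeta Azeta; rewrite leNgt; apply/negP => lt.
  pose c := energy eta - dot eta zeta; pose N := energy (fun e => 1 * zeta e + (-1) * eta e).
  have c0 : 0 < c by rewrite subr_gt0.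
  have N0 : 0 <= N by exact: energy_ge0.
  (* On the segment the energy is [energy eta - 2 s c + s^2 N]. This [s] lies in [(0, 1]] and
     satisfies [c - s N = s c], so the energy drops strictly even when [N = 0]. *)
  pose s := c / (c + N).
  have cN0 : 0 < c + N by rewrite ltr_pwDl.
  have sc : s * (c + N) = c by rewrite /s divfK // gt_eqF.
  have s0 : 0 < s by rewrite divr_gt0.
  have s1 : s <= 1 by rewrite ler_pdivrMr // mul1r lerDl.
  have : energy eta <= energy (fun e => (1 - s) * eta e + s * zeta e).
    by rewrite -lee_fin opt Mod2_le //; apply: Adm_convex; rewrite ?(ltW s0).
  have NE : N = energy zeta - dot eta zeta *+ 2 + energy eta.
    by rewrite /N energy_combine (dotC zeta); ring.
  rewrite energy_combine.
  have -> : (1 - s) ^+ 2 * energy eta + (1 - s) * s * dot eta zeta *+ 2 + s ^+ 2 * energy zeta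
    = energy eta - s * c - s * (c - s * N) by rewrite NE /c; ring.
  have -> : c - s * N = s * c by rewrite -{1}sc; ring.
  have := mulr_gt0 s0 c0; have := mulr_gt0 s0 (mulr_gt0 s0 c0); lra.
apply/eqP; rewrite eq_le Mod2_le // andbT.
apply/ereal_infP => _ [zeta Azeta <-]; rewrite lee_fin.
have := energy_ge0 (fun e => 1 * zeta e + (-1) * eta e).
have := opt _ Azeta; rewrite energy_combine (dotC zeta); lra.
Qed.

End Optimality.

Section CutDominant.
Variables (R : realType) (H : hypergraph).
Implicit Types (zeta : edge H -> R) (m : {ffun edge H -> nat}).

(** The partition inequalities, with the 1 moved to the right. The color type is arbitrary so that
    colorings can be composed and glued. *)
Definition cut_dominant zeta : Prop :=
  (forall e, 0 <= zeta e) /\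
  forall (T : finType) (g : vert H -> T),
    #|g @: [set: vert H]%SET|%:R <= 1 + \sum_(e in cut g) zeta e.

(** A monochromatic hyperedge lies in one color class, and each class holds fewer members than
    vertices; summing over the classes leaves the rest of the [|V| - 1] members to the cut. *)
Lemma multitree_cut m (T : finType) (g : vert H -> T) : (0 < #|vert H|)%N ->
  multitree m -> (#|g @: [set: vert H]%SET| <= (\sum_(e in cut g) m e).+1)%N.
Proof.
move=> V0 /andP[_ /andP[fm /eqP sm]].
suff : (\sum_(e | e \notin cut g) m e + #|g @: [set: vert H]%SET| <= #|vert H|)%N.
  move: sm; rewrite (bigID (mem (cut g))) /=; move: V0.
  by move: #|vert H| => n n0 sm; lia.
rewrite -(card_fibers g).
apply: (@leq_trans (\sum_(x in g @: [set: vert H]%SET) (inner m (g @^-1: [set x])%SET + 1))).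
  rewrite big_split /= sum1_card leq_add2r /inner (exchange_big_dep predT) //=.
  rewrite big_mkcond; apply: leq_sum => e _; case: ifPn => // /notin_cutP gc.
  have [v ve] := inc_neq0 e; rewrite (bigD1 (g v)) /= ?leq_addr //.
  rewrite imset_f ?inE //=; apply/fintype.subsetP => w we.
  by rewrite !inE (gc w v) ?eqxx.
apply: leq_sum => x /imsetP[v _ ->]; rewrite addn1; apply: (hyperforestP _ fm).
by apply/finset.set0Pn; exists v; rewrite !inE.
Qed.

(** Multiplicities in a hypertree are at most [|V| - 1], so the family is finite, as
    [blocker_dot_le] requires. *)
Lemma Omega_range : exists (J : finType) (gam : J -> edge H -> R),
  Omega R H = [set gam j | j in [set: J]%classic]%classic.
Proof.
pose nat_of (f : {ffun edge H -> 'I_(#|vert H|.-1).+1}) : {ffun edge H -> nat} :=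
  [ffun e => f e : nat].
exists {f | multitree (nat_of f)}; exists (fun j e => (nat_of (val j) e)%:R).
apply/seteqP; split=> [_ [m mt <-]|_ [j _ <-]]; last by exists (nat_of (val j)) => //; exact: (valP j).
have mE : m = nat_of [ffun e => inord (m e)].
  apply/ffunP => e; rewrite !ffunE inordK // ltnS.
  have /andP[_ /andP[_ /eqP <-]] := mt.
  by rewrite (bigD1 e) //= leq_addr.
have mt' : multitree (nat_of [ffun e => inord (m e)]) by rewrite -mE.
by exists (exist (fun f => multitree (nat_of f)) _ mt') => //=; rewrite -mE.
Qed.

Lemma Omega_admP rho : Adm (Omega R H) rho <->
  (forall e, 0 <= rho e) /\
  forall m, multitree m -> 1 <= dot (fun e => (m e)%:R) rho.
Proof.
split=> -[r0 Ar]; split=> //; first by move=> m mt; apply: Ar; exists m.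
by move=> _ [m mt <-]; exact: Ar.
Qed.

Hypotheses (conn : hconnected H) (V1 : (1 < #|vert H|)%N).

Lemma greedy_cut_dominant (rho : edge H -> R) : exists2 m, multitree m &
  forall t, exists g : vert H -> {set vert H},
    [/\ {in cut g, forall e, t <= rho e},
        1 + \sum_(e | t <= rho e) (m e)%:R <= #|g @: [set: vert H]%SET|%:R :> R
      & forall zeta, cut_dominant zeta ->
          \sum_(e in cut g) zeta e <= \sum_(e | t <= rho e) zeta e].
Proof.
have [m mt lev] := greedy_tree rho conn V1; exists m => // t.
have [g [gc gm]] := lev t; exists g; split=> //.
  by rewrite -natr_sum nat1r ler_nat.
move=> zeta [z0 _]; rewrite big_mkcond [leRHS]big_mkcond; apply: ler_sum => e _.
by case: ifPn => [/gc ->//|_]; case: ifP.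
Qed.

Lemma blocker_OmegaP zeta : Adm (blocker (Omega R H)) zeta <-> cut_dominant zeta.
Proof.
split=> [[z0 Az]|zd].
  split=> // T g; set k := #|_|.
  have cut0 : 0 <= \sum_(e in cut g) zeta e by exact: sumr_ge0.
  case: (leqP k 1) => k1.
    by rewrite (@le_trans _ _ 1) ?lerDl // -[leRHS]/1%:R ler_nat.
  have k0 : 0 < k%:R - 1 :> R by rewrite subr_gt0 -[ltLHS]/1%:R ltr_nat.
  (* Every multi-tree has at least [k - 1] members in the cut, so this value makes the density
     admissible. *)
  pose rho e : R := if e \in cut g then (k%:R - 1)^-1 else 0.
  have dotrho x : dot x rho = (\sum_(e in cut g) x e) / (k%:R - 1).
    rewrite /dot mulr_suml [RHS]big_mkcond; apply: eq_bigr => e _.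
    by rewrite /rho; case: ifP; rewrite ?mulr0.
  have Arho : Adm (Omega R H) rho.
    apply/Omega_admP; split=> [e|m mt]; first by rewrite /rho; case: ifP => // _; rewrite invr_ge0 ltW.
    rewrite dotrho ler_pdivlMr // mul1r lerBlDl -natr_sum nat1r ler_nat.
    by apply: multitree_cut => //; exact: ltnW.
  have [J [gam GE]] := Omega_range; rewrite GE in Arho.
  have [rho' brho' le] := blocker_dot_le z0 Arho; rewrite -GE in brho'.
  have := Az _ brho'; rewrite -/(dot _ _) dotC => h.
  by have := le_trans h le; rewrite dotrho ler_pdivlMr // mul1r lerBlDl.
split; first exact: zd.1.
move=> rho [/Omega_admP[r0 Ar] _]; rewrite -/(dot _ _) dotC.
have [m mt lev] := greedy_cut_dominant rho.
apply: le_trans (Ar m mt) _.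
(* On each level set of [rho], [zeta] has at least the mass of the greedy tree, hence
   [dot zeta rho >= dot m rho >= 1]. *)
have [|] := @dot_levels _ _ (fun e => 1 * zeta e + (-1) * (m e)%:R) rho r0.
  move=> t _; have [g [_ gm /(_ _ zd) gz]] := lev t.
  by rewrite big_split /= -!mulr_sumr; have := zd.2 _ g; lra.
by rewrite dotC dot_combine !(dotC rho); lra.
Qed.

Lemma multitree_cut_dominant m : multitree m -> cut_dominant (fun e => (m e)%:R).
Proof.
move=> mt; split=> [e|T g]; first exact: ler0n.
by rewrite -natr_sum nat1r ler_nat; apply: multitree_cut => //; exact: ltnW.
Qed.

(** The partition inequality for the partition into singletons. *)
Lemma card_vert_le zeta : cut_dominant zeta -> #|vert H|%:R <= 1 + \sum_e zeta e.
Proof.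
move=> [z0 zd]; have := zd _ (fun v => v); rewrite imset_id cardsT => /le_trans; apply.
rewrite lerD2l big_mkcond; apply: ler_sum => e _.
by case: ifP.
Qed.

Lemma optimal_levels eta : optimal_density (blocker (Omega R H)) eta ->
  (forall e, 0 < eta e) /\
  forall t, 0 < t -> exists g : vert H -> {set vert H},
    cut g = [set e | t <= eta e]%SET /\
    1 + \sum_(e | t <= eta e) eta e = #|g @: [set: vert H]%SET|%:R.
Proof.
move=> /optimal_densityP[/blocker_OmegaP ed opt].
have e0 := ed.1.
have [m mt lev] := greedy_cut_dominant eta.
have [|d0 dz] := @dot_levels _ _ (fun e => 1 * eta e + (-1) * (m e)%:R) eta e0.
  move=> t _; have [g [_ gm /(_ _ ed) gz]] := lev t.
  by rewrite big_split /= -!mulr_sumr; have := ed.2 _ g; lra.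
(* Since [m] is itself admissible, optimality gives [dot eta m >= energy eta], so [dot d eta = 0]
   for [d = eta - m] and every level sum of [d] vanishes. *)
have {dz}levE t : 0 < t -> \sum_(e | t <= eta e) eta e = \sum_(e | t <= eta e) (m e)%:R.
  move=> t0; have := dz _ t t0; rewrite big_split /= -!mulr_sumr => h.
  have := opt _ ((blocker_OmegaP _).2 (multitree_cut_dominant mt)).
  rewrite energy_dot; move: d0 h; rewrite !(dotC _ eta) dot_combine; lra.
(* The chain from the level mass of [m] through the number of colors minus one and [eta (cut g)] to
   the level mass of [eta] now has equal ends. *)
have lev' t : 0 < t -> exists g : vert H -> {set vert H},
    [/\ {in cut g, forall e, t <= eta e},
        \sum_(e in cut g) eta e = \sum_(e | t <= eta e) eta e
      & 1 + \sum_(e | t <= eta e) eta e = #|g @: [set: vert H]%SET|%:R].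
  move=> t0; have [g [gc gm /(_ _ ed) gz]] := lev t; exists g.
  have := ed.2 _ g; have := levE t t0 => h1 h2.
  by split=> //; lra.
(* At the least positive value of [eta], the coloring is injective, so that
   all hyperedges belong to its cut. *)
have epos e : 0 < eta e.
  have [f0 f0_pos] : exists f, 0 < eta f.
    apply: contrapT => nex; have := card_vert_le ed; rewrite big1 ?addr0.
      by rewrite -[leRHS]/1%:R ler_nat leqNgt V1.
    move=> f _; apply/eqP; rewrite eq_le e0 andbT leNgt; apply/negP => fp.
    by apply: nex; exists f.
  case: (@arg_minP _ _ _ f0 (fun f => 0 < eta f) eta f0_pos) => f1 f1_pos f1min.
  have [g [gc _ gE]] := lev' _ f1_pos.
  apply: lt_le_trans f1_pos _; apply: gc.
  (* The level of [f1] carries the total mass of [eta], so the number of colors is at least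
     [|V|]. *)
  have inj : injective g.
    suff /imset_injP inj : #|g @: [set: vert H]%SET| == #|[set: vert H]%SET|.
      by move=> u v; apply: inj; rewrite inE.
    rewrite eqn_leq leq_imset_card cardsT -(ler_nat R) -gE.
    apply: le_trans (card_vert_le ed) _; rewrite lerD2l [leRHS]big_mkcond.
    apply: ler_sum => f _; case: ifPn => // h; rewrite leNgt; apply: contra h.
    exact: f1min.
  apply: contraT => /notin_cutP gce.
  have /card_gt1P[u [v [ue ve /eqP]]] := inc_gt1 e.
  by case; apply: inj; exact: gce.
split=> // t t0; have [g [gc gs gE]] := lev' t t0; exists g; split=> //.
apply/finset.setP => e; rewrite [in RHS]inE; apply/idP/idP; first exact: gc.
(* The cut and the level set carry the same mass, so the level set has no hyperedge of positive
   density outside the cut. *)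
move=> te; apply: contraT => ncut; have := gs.
rewrite [RHS](bigID (mem (cut g))) /=.
rewrite [X in _ = X + _](eq_bigl (mem (cut g))); last first.
  by move=> f; rewrite /= andbC; case: (boolP (f \in cut g)) => //= /gc ->.
rewrite [X in _ = _ + X](bigD1 e) /= ?te ?ncut //.
have : 0 <= \sum_(i | (t <= eta i) && (i \notin cut g) && (i != e)) eta i by exact: sumr_ge0.
by have := epos e; lra.
Qed.

End CutDominant.

(** * Restriction to a component *)

Lemma maximizers_level (R : realType) (E : finType) (eta : E -> R) f0 e :
  f0 \in maximizers eta -> (e \in maximizers eta) = (eta f0 <= eta e).
Proof.
rewrite inE => /forallP f0max; rewrite inE; apply/forallP/idP => [|le f]; first exact.
exact: le_trans le.
Qed.

Lemma exists_maximizer (R : realType) (H : hypergraph) (eta : edge H -> R) :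
  hconnected H -> (1 < #|vert H|)%N -> exists f, f \in maximizers eta.
Proof.
move=> conn /card_gt1P[u [v [_ _ uv]]].
(* Without hyperedges the identity coloring would have empty cut, hence be constant. *)
have [e _] : exists e : edge H, true.
  apply: contrapT => noe; case/eqP: uv.
  by apply: (connected_coloring (g := id) conn) => e; case: noe; exists e.
exists [arg max_(f > e) eta f]%O; case: arg_maxP => // f _ fmax; rewrite inE.
by apply/forallP => f'; exact: fmax.
Qed.

Section Piece.
Variables (R : realType) (H L : hypergraph).
(** The component is given by abstract embeddings, which hides the two layers of subtypes of a
    component of an induced hypergraph. *)
Variables (phi : vert L -> vert H) (psi : edge L -> edge H).
Hypotheses (psi_inj : injective psi) (phi_inj : injective phi).
Hypothesis inc_psi : forall e, inc (psi e) = [set phi u | u in inc e]%SET.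

Lemma cut_psi (T : finType) (g : vert H -> T) e :
  (psi e \in cut g) = (e \in cut (g \o phi)).
Proof.
apply: negb_inj; apply/notin_cutP/notin_cutP => gc u v.
  by move=> ue ve; apply: gc; rewrite inc_psi imset_f.
by rewrite inc_psi => /imsetP[u' u'e ->] /imsetP[v' v'e ->]; exact: gc.
Qed.

(* Colors the image of [L] by [g] and the other vertices by [k]. *)
Definition extend (T S : finType) (g : vert L -> T) (k : vert H -> S) v : T + S :=
  if [pick u | phi u == v] is Some u then inl (g u) else inr (k v).

Section Extend.
Variables (T S : finType) (g : vert L -> T) (k : vert H -> S).

Lemma extend_phi u : extend g k (phi u) = inl (g u).
Proof.
rewrite /extend; case: pickP => [u' /eqP/phi_inj -> //|/(_ u)].
by rewrite eqxx.
Qed.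

Lemma extendN v : v \notin phi @: [set: vert L]%SET -> extend g k v = inr (k v).
Proof.
rewrite /extend; case: pickP => // u /eqP <-; by rewrite imset_f ?inE.
Qed.

(** All colors of [g] survive in the left summand, and [k] loses at most the colors that it uses on
    the image of [L]. *)
Lemma card_extend :
  (#|g @: [set: vert L]%SET| + #|k @: [set: vert H]%SET| <=
   #|extend g k @: [set: vert H]%SET| + #|(k \o phi) @: [set: vert L]%SET|)%N.
Proof.
set gL := g @: _; set kH := k @: _; set kL := (k \o phi) @: _.
have sub : inl @: gL :|: inr @: (kH :\: kL) \subset extend g k @: [set: vert H]%SET.
  rewrite finset.subUset; apply/andP; split; apply/fintype.subsetP => x /imsetP[y].
    by move=> /imsetP[u _ ->] ->; rewrite -extend_phi imset_f ?inE.
  rewrite finset.inE => /andP[nkL /imsetP[v _ ey]] ->.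
  rewrite ey -extendN ?imset_f ?inE //; apply: contra nkL => /imsetP[u _ vu].
  by rewrite ey vu; apply/imsetP; exists u.
have := subset_leq_card sub.
have -> : #|inl @: gL :|: inr @: (kH :\: kL)| = (#|gL| + #|kH :\: kL|)%N.
  rewrite -(card_imset gL (@inl_inj T S)) -(card_imset (kH :\: kL) (@inr_inj T S)).
  rewrite -cardsUI [X in _ = (_ + X)%N](_ : _ = 0%N) ?addn0 //; apply: eq_card0 => x; rewrite inE.
  by apply/negP => /andP[/imsetP[y _ ->] /imsetP[z _]].
have := cardsID kL kH; have := subset_leq_card (finset.subsetIr kH kL).
by move: #|kL| #|kH| => *; lia.
Qed.

Lemma cut_extend_psi e : psi e \in cut (extend g k) -> e \in cut g.
Proof.
rewrite cut_psi; apply: contraTT => /notin_cutP gc; apply/notin_cutP => u v ue ve /=.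
by rewrite !extend_phi (gc u v).
Qed.

Lemma cut_extend_disjoint f : [disjoint inc f & phi @: [set: vert L]%SET] ->
  f \in cut (extend g k) -> f \in cut k.
Proof.
move=> dis; apply: contraTT => /notin_cutP kc.
apply/notin_cutP => u v uf vf.
by rewrite !extendN ?(kc u v) ?(disjointFr dis).
Qed.

End Extend.

Hypotheses (connH : hconnected H) (V1H : (1 < #|vert H|)%N).
Hypotheses (connL : hconnected L) (V1L : (1 < #|vert L|)%N).
Variable (eta : edge H -> R).
Hypothesis eta_opt : optimal_density (blocker (Omega R H)) eta.
Hypothesis psi_lt : forall e, psi e \notin maximizers eta.
(* [L] is a component of the hypergraph of the non-maximal hyperedges. *)
Hypothesis dichotomy : forall f, f \notin maximizers eta ->
  (exists e, f = psi e) \/ [disjoint inc f & phi @: [set: vert L]%SET].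

Lemma sum_psi (P : pred (edge H)) :
  \sum_(e | P (psi e)) eta (psi e) = \sum_(f in psi @: [set e | P (psi e)]%SET) eta f.
Proof.
rewrite big_imset /=; last by move=> e e' _ _; exact: psi_inj.
by apply: eq_bigl => e; rewrite inE.
Qed.

(** Glue [g] to a coloring [k] whose cut is [E_max]. The glued cut lies in the union of [E_max] and
    the image of [cut g], and the tightness of [k] cancels the contribution of [E_max]. *)
Lemma piece_dominant : cut_dominant (fun e => eta (psi e)).
Proof.
have [epos lev] := optimal_levels connH V1H eta_opt.
have ed := (blocker_OmegaP connH V1H eta).1 ((optimal_densityP _ _).1 eta_opt).1.
split=> [e|T g]; first exact: ltW.
have [f0 f0max] := exists_maximizer eta connH V1H.
have [k [kcut ksum]] := lev _ (epos f0).
(* No hyperedge of the connected [L] is maximal, so none is cut by [k] and gluing loses only one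
   color of [k]. *)
have kL : #|(k \o phi) @: [set: vert L]%SET| = 1%N.
  have [u _] : exists u, u \in vert L by apply/card_gt0P/ltnW.
  apply/eqP/cards1P; exists (k (phi u)); apply/finset.setP => X.
  rewrite inE; apply/imsetP/eqP => [[v _ ->]|->]; last by exists u.
  apply: (connected_coloring (g := k \o phi) connL) => e.
  by rewrite -cut_psi kcut inE -(maximizers_level _ f0max) psi_lt.
have := ed.2 _ (extend g k).
have : \sum_(f in cut (extend g k)) eta f <=
    \sum_(f | eta f0 <= eta f) eta f + \sum_(e in cut g) eta (psi e).
  rewrite -(big_imset eta (h := psi)) /=; last by move=> e e' _ _; exact: psi_inj.
  rewrite [leLHS]big_mkcond [X in X + _]big_mkcond [X in _ + X]big_mkcond -big_split.
  apply: ler_sum => f _ /=; have ef := ltW (epos f).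
  case: ifPn => fc; last by do 2 case: ifP; rewrite ?addr0 ?add0r // addr_ge0.
  case: ifPn => fm; first by case: ifP; rewrite ?addr0 // lerDl.
  rewrite -(maximizers_level _ f0max) in fm.
  case: (dichotomy fm) => [[e fe]|dis].
    by rewrite fe imset_f ?add0r -?fe //; apply: cut_extend_psi; rewrite -fe; exact: fc.
  have := cut_extend_disjoint dis fc.
  by rewrite kcut inE -(maximizers_level _ f0max) (negPf fm).
have := card_extend g k; rewrite kL -(ler_nat R) !natrD -ksum; lra.
Qed.

(* Testing [eta] on [extend g k], with [g] constant and [cut k = {eta >= t}],
   bounds the mass of [eta] on the level set inside [L]; that of [zeta] is
   bounded below by the coloring [k \o phi]. *)
Lemma piece_level t zeta : 0 < t -> cut_dominant zeta ->
  \sum_(e | t <= eta (psi e)) eta (psi e) <= \sum_(e | t <= eta (psi e)) zeta e.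
Proof.
move=> t0 zd.
have [epos lev] := optimal_levels connH V1H eta_opt.
have ed := (blocker_OmegaP connH V1H eta).1 ((optimal_densityP _ _).1 eta_opt).1.
have [f0 f0max] := exists_maximizer eta connH V1H.
case: (leP t (eta f0)) => tf0; last first.
  have lt e : (t <= eta (psi e)) = false.
    apply/negbTE; rewrite -ltNge (le_lt_trans _ tf0) //.
    by move: f0max; rewrite inE => /forallP.
  by rewrite !big_pred0.
have [k [kcut ksum]] := lev _ t0.
pose g (u : vert L) := tt.
have gL : #|g @: [set: vert L]%SET| = 1%N.
  have [u _] : exists u, u \in vert L by apply/card_gt0P/ltnW.
  apply/eqP/cards1P; exists tt; apply/finset.setP => -[].
  by rewrite inE eqxx; apply/imsetP; exists u.
have := ed.2 _ (extend g k).
(* With [g] constant, the glued cut avoids the hyperedges of [L], and outside [L] it stays within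
   the level set. *)
have : \sum_(f in cut (extend g k)) eta f + \sum_(e | t <= eta (psi e)) eta (psi e) <=
    \sum_(f | t <= eta f) eta f.
  rewrite (sum_psi (fun f => t <= eta f)).
  rewrite [X in X + _]big_mkcond [X in _ + X]big_mkcond [leRHS]big_mkcond -big_split.
  apply: ler_sum => f _ /=; have ef := ltW (epos f).
  case: (boolP (f \in psi @: _)) => [/imsetP[e + ->]|nf].
    rewrite inE => ->; case: ifP => [/cut_extend_psi|]; last by rewrite add0r.
    by rewrite inE => /exists_inP[u _ /exists_inP[v _]]; rewrite eqxx.
  rewrite addr0; case: ifPn => fc; last by case: ifP.
  case: ifPn => // ft.
  have fm : f \notin maximizers eta.
    by rewrite (maximizers_level _ f0max); apply: contra ft; exact: le_trans.
  case: (dichotomy fm) => [[e fe]|dis].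
    move: fc; rewrite fe => /cut_extend_psi.
    by rewrite inE => /exists_inP[u _ /exists_inP[v _]]; rewrite eqxx.
  by have := cut_extend_disjoint dis fc; rewrite kcut inE (negPf ft).
have : \sum_(e in cut (k \o phi)) zeta e <= \sum_(e | t <= eta (psi e)) zeta e.
  rewrite big_mkcond [leRHS]big_mkcond; apply: ler_sum => e _.
  by rewrite -cut_psi kcut inE; case: ifP => // _.
have := zd.2 _ (k \o phi).
have := card_extend g k; rewrite gL -(ler_nat R) !natrD -ksum; lra.
Qed.

(** The level estimates sum to [dot zeta eta >= energy eta] on the piece, which is the variational
    inequality. *)
Lemma piece_optimal : optimal_density (blocker (Omega R L)) (fun e => eta (psi e)).
Proof.
have pd := piece_dominant.
apply/optimal_densityP; split; first exact/blocker_OmegaP.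
move=> zeta /blocker_OmegaP zd; rewrite energy_dot.
have [|] := @dot_levels _ _ (fun e => 1 * zeta e + (-1) * eta (psi e)) (fun e => eta (psi e)) pd.1.
  move=> t t0; rewrite big_split /= -!mulr_sumr.
  by have := piece_level t0 (zd connL V1L); lra.
by rewrite !(dotC _ (fun e => eta (psi e))) dot_combine; lra.
Qed.

End Piece.

(** * Contraction *)

Section Contraction.
Variables (H : hypergraph) (F : {set edge H}).
Local Notation conn_F := (connect (share_edge F)).

Lemma merge_equiv : {in [set: vert H]%SET & &, equivalence_rel conn_F}.
Proof.
have sym : connect_sym (share_edge F).
  apply: sym_connect_sym => u v; apply: eq_existsb => e.
  by rewrite (andbC (u \in _)).
move=> u v w _ _ _; split=> [|uv]; first exact: connect0.
by apply/idP/idP; apply: connect_trans => //; rewrite sym.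
Qed.

Lemma merge_class_proof (v : vert H) : finset.pblock (merged_classes F) v \in merged_classes F.
Proof.
have /and3P[/eqP cov _ _] := equivalence_partitionP merge_equiv.
by apply: finset.pblock_mem; rewrite cov inE.
Qed.

(** The quotient map, used as a coloring of the vertices of [H] by those of [H/F]. *)
Definition merge v : vert (contraction F) :=
  exist (fun B => B \in merged_classes F) _ (merge_class_proof v).

Lemma mem_merge u v : (v \in val (merge u)) = conn_F u v.
Proof. by rewrite /= (pblock_equivalence_partition merge_equiv) ?inE. Qed.

Lemma mergeE (B : vert (contraction F)) v : (v \in val B) = (merge v == B).
Proof.
have /and3P[_ tI _] := equivalence_partitionP merge_equiv.
apply/idP/eqP => [vB|<-]; last by rewrite mem_merge connect0.
by apply/val_inj; rewrite /= (finset.def_pblock tI (valP B) vB).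
Qed.

Lemma merge_surj (B : vert (contraction F)) : exists v, merge v = B.
Proof.
have /and3P[_ _ n0] := equivalence_partitionP merge_equiv.
have : val B != finset.set0 by apply: contraNneq n0 => <-; exact: (valP B).
by move=> /finset.set0Pn[v]; rewrite mergeE => /eqP <-; exists v.
Qed.

Lemma merge_imsetT : merge @: [set: vert H]%SET = [set: vert (contraction F)]%SET.
Proof.
apply/finset.setP => B; rewrite [RHS]inE; have [v <-] := merge_surj B.
by rewrite imset_f ?inE.
Qed.

Lemma image_edgeE e : image_edge F e = [set merge v | v in inc e]%SET.
Proof.
apply/finset.setP => B; rewrite inE; apply/finset.set0Pn/imsetP => [[v]|[v ve ->]].
  by rewrite inE mergeE => /andP[/eqP <- ve]; exists v.
by exists v; rewrite inE mergeE eqxx.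
Qed.

Lemma cut_merge e : (e \in cut merge) = (1 < #|image_edge F e|)%N.
Proof.
rewrite image_edgeE; apply/idP/card_gt1P => [|[_ [_ [/imsetP[u ue ->] /imsetP[v ve ->] uv]]]].
  rewrite inE => /exists_inP[u ue /exists_inP[v ve uv]].
  by exists (merge u), (merge v); split; rewrite ?imset_f.
by apply: contraT => /notin_cutP mc; rewrite (mc u v) ?eqxx in uv.
Qed.

Lemma cut_mergeN e : e \in F -> e \notin cut merge.
Proof.
move=> eF; apply/notin_cutP => u v ue ve; apply/eqP.
rewrite -mergeE mem_merge connect1 //.
by apply/exists_inP; exists e; rewrite ?ve ?ue.
Qed.

Lemma contract_edgesE : contract_edges F = cut merge.
Proof.
apply/finset.setP => e; rewrite inE -cut_merge.
by case: (boolP (e \in F)) => //= /cut_mergeN /negPf ->.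
Qed.

Lemma merge_factor (T : finType) (k : vert H -> T) :
  (forall e, e \in F -> e \notin cut k) -> forall u v, merge u = merge v -> k u = k v.
Proof.
move=> Fk u v /eqP; rewrite -mergeE mem_merge => /connectP[p].
elim: p v u => [|w p IH] v u /=; first by move=> _ ->.
move=> /andP[/exists_inP[e eF /andP[we ue]] pp] ve.
rewrite (IH w u pp ve).
by have /notin_cutP := Fk e eF; apply.
Qed.

Lemma contracted_mem (e : edge (contraction F)) : contracted_edge e \in contract_edges F.
Proof. exact: (valP e). Qed.

Lemma cut_contracted (T : finType) (g : vert (contraction F) -> T)
    (e : edge (contraction F)) :
  (contracted_edge e \in cut (g \o merge)) = (e \in cut g).
Proof.
have incE : inc e = [set merge v | v in inc (contracted_edge e)]%SET by rewrite -image_edgeE.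
apply: negb_inj; apply/notin_cutP/notin_cutP => gc u v.
  by rewrite incE => /imsetP[u' u'e ->] /imsetP[v' v'e ->]; exact: gc.
by move=> ue ve /=; apply: gc; rewrite incE imset_f.
Qed.

(** Membership of [merge u] in [S] is a coloring of [H]. A hyperedge in its cut is not merged to a
    point, so it survives in [H/F] and would cross [S]. *)
Lemma contraction_connected : hconnected H -> hconnected (contraction F).
Proof.
move=> connH; apply/hconnectedP => S inS.
have const : forall u v, (merge u \in S) = (merge v \in S).
  apply: (connected_coloring (g := fun u => merge u \in S) connH) => e.
  apply: contraT; rewrite negbK => eS.
  have ec : e \in contract_edges F.
    rewrite contract_edgesE; apply: contraLR eS => /notin_cutP mc.
    by apply/notin_cutP => u v ue ve; rewrite (mc u v).
  pose e' : edge (contraction F) := exist (fun e => e \in contract_edges F) e ec.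
  have := inS e'; have incE : inc e' = [set merge v | v in inc e]%SET by rewrite -image_edgeE.
  move: eS; rewrite inE => /exists_inP[u ue /exists_inP[v ve /negP uv]].
  have ue' : merge u \in inc e' by rewrite incE imset_f.
  have ve' : merge v \in inc e' by rewrite incE imset_f.
  case/orP => /fintype.subsetP sub; case: uv.
    by rewrite !sub.
  by have := sub _ ue'; have := sub _ ve'; rewrite !inE => /negPf -> /negPf ->.
case: (finset.set_0Vmem S) => [|[B BS]]; first by left.
right; apply/finset.setP => C; rewrite [RHS]inE.
have [u uB] := merge_surj B; have [v vC] := merge_surj C.
by rewrite -vC (const v u) uB.
Qed.

Lemma sum_contracted (R : realType) (P : pred (edge H)) (f : edge H -> R) :
  \sum_(e : edge (contraction F) | P (contracted_edge e)) f (contracted_edge e) =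
  \sum_(e in contract_edges F | P e) f e.
Proof.
rewrite -(big_imset (h := @contracted_edge H F) f) /=; last by move=> x y _ _; exact: val_inj.
apply: eq_bigl => e; apply/imsetP/andP => [[e' Pe' ->]|[eC Pe]].
  by split=> //; exact: (valP e').
by exists (exist (fun e => e \in contract_edges F) e eC).
Qed.

End Contraction.

(** * The maximal level and the contracted hypergraph *)

Section TopLevel.
Variables (R : realType) (H : hypergraph) (eta : edge H -> R).
Hypotheses (connH : hconnected H) (V1H : (1 < #|vert H|)%N).
Hypothesis eta_opt : optimal_density (blocker (Omega R H)) eta.
Local Notation F := (~: maximizers eta)%SET.
Variable f0 : edge H.
Hypothesis f0max : f0 \in maximizers eta.

(** Take [k] tight with cut [E_max]. Then [|k(V)| <= |V(H/F)| <= 1 + eta (cut merge) <= 1 + eta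
    (E_max) = |k(V)|]; equality and positivity of [eta] give both claims. *)
Lemma top_level :
  cut (@merge H F) = maximizers eta /\
  1 + \sum_(e in maximizers eta) eta e = #|vert (contraction F)|%:R.
Proof.
have [epos lev] := optimal_levels connH V1H eta_opt.
have ed := (blocker_OmegaP connH V1H eta).1 ((optimal_densityP _ _).1 eta_opt).1.
have [k [kcut ksum]] := lev _ (epos f0).
have maxE e : (e \in maximizers eta) = (eta f0 <= eta e) := maximizers_level e f0max.
(* [k] is constant on the members of [F], so it factors through [merge]; [k'] evaluates it at a
   chosen representative. *)
have kle : (#|k @: [set: vert H]%SET| <= #|vert (contraction F)|)%N.
  have kF e : e \in F -> e \notin cut k by rewrite inE kcut inE maxE.
  pose k' (B : vert (contraction F)) := k (sval (cid (merge_surj B))).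
  have -> : k @: [set: vert H]%SET = k' @: (@merge H F @: [set: vert H]%SET).
    rewrite -imset_comp; apply: eq_imset => v; rewrite /= /k'.
    by apply: (merge_factor kF); rewrite (svalP (cid (merge_surj (merge F v)))).
  by rewrite merge_imsetT (leq_trans (leq_imset_card _ _)) ?cardsT.
have sub : cut (@merge H F) \subset maximizers eta.
  apply/fintype.subsetP => e; apply: contraLR => em; apply: cut_mergeN.
  by rewrite inE.
have := ed.2 _ (@merge H F); rewrite merge_imsetT cardsT.
have sumE : \sum_(e | eta f0 <= eta e) eta e = \sum_(e in maximizers eta) eta e.
  by apply: eq_bigl => e; rewrite maxE.
rewrite sumE in ksum; move: kle; rewrite -(ler_nat R) -ksum => h1 h2.
have sumD : \sum_(e in maximizers eta) eta e = \sum_(e in cut (@merge H F)) eta e +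
    \sum_(e in maximizers eta :\: cut (@merge H F)) eta e.
  by rewrite (big_setID (cut (@merge H F))) /= (finset.setIidPr sub).
have rest0 : 0 <= \sum_(e in maximizers eta :\: cut (@merge H F)) eta e.
  by apply: sumr_ge0 => e _; exact: ltW.
split; last by move: h1 h2; lra.
apply/eqP; rewrite finset.eqEsubset sub; apply/fintype.subsetP => e em.
apply: contraT => ec; have : e \in maximizers eta :\: cut (@merge H F) by rewrite inE ec.
move=> eD; have : \sum_(e in maximizers eta :\: cut (@merge H F)) eta e <= 0.
  by move: h1 h2; lra.
rewrite (bigD1 e eD) /=; have := epos e.
have : 0 <= \sum_(i in maximizers eta :\: cut (@merge H F) | i != e) eta i.
  by apply: sumr_ge0 => i _; exact: ltW.
by lra.
Qed.

(** Here [eta] is constant, so the variational inequality only compares total masses. That of any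
    admissible [zeta] is at least [|V(H/F)| - 1], which [eta] attains by [top_level]. *)
Lemma quotient_optimal :
  optimal_density (blocker (Omega R (contraction F))) (fun e => eta (contracted_edge e)).
Proof.
have [epos _] := optimal_levels connH V1H eta_opt.
have ed := (blocker_OmegaP connH V1H eta).1 ((optimal_densityP _ _).1 eta_opt).1.
have [cutE sumE] := top_level.
have connQ := contraction_connected F connH.
have V1Q : (1 < #|vert (contraction F)|)%N.
  rewrite -(ltr_nat R) -sumE ltrDl (bigD1 f0) //= ltr_pwDl //.
  by apply: sumr_ge0 => e _; exact: ltW.
have etaQ (e : edge (contraction F)) : eta (contracted_edge e) = eta f0.
  have em : contracted_edge e \in maximizers eta.
    move: (contracted_mem e); move: (contracted_edge e) => f.
    by rewrite contract_edgesE cutE.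
  apply/eqP; rewrite eq_le -(maximizers_level _ f0max) em andbT.
  by move: f0max; rewrite inE => /forallP.
apply/optimal_densityP; split.
  apply/blocker_OmegaP => //; split=> [e|T g]; first exact: ltW.
  (* The pullback to [H] of a coloring of the quotient has the same colors and the same cut. *)
  have := ed.2 _ (g \o @merge H F).
  have -> : (g \o @merge H F) @: [set: vert H]%SET = g @: [set: vert (contraction F)]%SET.
    by rewrite imset_comp merge_imsetT.
  move=> /le_trans; apply; rewrite lerD2l.
  rewrite [leRHS](eq_bigl (fun e => contracted_edge e \in cut (g \o @merge H F))); last first.
    by move=> e; rewrite /= cut_contracted.
  rewrite (sum_contracted F (fun e => e \in cut (g \o @merge H F)) eta).
  rewrite le_eqVlt; apply/orP; left; apply/eqP; apply: eq_bigl => e.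
  rewrite contract_edgesE andbC; case: (boolP (e \in cut (g \o _))) => //= eg; apply/esym.
  apply: contraLR eg => /notin_cutP mc; apply/notin_cutP => u v ue ve /=.
  by rewrite (mc u v).
move=> zeta /(blocker_OmegaP connQ V1Q) zd.
have -> : dot (fun e => eta (contracted_edge e)) zeta = eta f0 * \sum_e zeta e.
  by rewrite mulr_sumr; apply: eq_bigr => e _; rewrite etaQ.
have -> : energy (fun e : edge (contraction F) => eta (contracted_edge e)) =
    eta f0 * \sum_(e in maximizers eta) eta e.
  transitivity (\sum_(e : edge (contraction F) | predT (contracted_edge e))
                  eta f0 * eta (contracted_edge e)).
    by apply: eq_bigr => e _; rewrite expr2 {1}etaQ.
  rewrite (sum_contracted F predT (fun e => eta f0 * eta e)) mulr_sumr.
  by apply: eq_bigl => e; rewrite contract_edgesE cutE andbT.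
rewrite ler_pM2l //; have := card_vert_le zd; rewrite -sumE; lra.
Qed.

End TopLevel.

(** * Components *)

Section Subhypergraph.
Variables (H : hypergraph) (X : {set vert H}) (A : {set edge H}).

Lemma subhyper_edge_inc (e : edge (subhyper X A)) :
  inc (subhyper_edge e) = [set val v | v in inc e]%SET.
Proof.
have /andP[_ /fintype.subsetP eX] := valP e.
apply/finset.setP => v; apply/idP/imsetP => [ve|[w + ->]]; last by rewrite inE.
by exists (exist (fun v => v \in X) v (eX v ve)); rewrite ?inE.
Qed.

Lemma subhyper_edgeP e :
  reflect (exists e' : edge (subhyper X A), e = subhyper_edge e')
          ((e \in A) && (inc e \subset X)).
Proof.
apply: (iffP idP) => [eAX|[e' ->]]; last exact: (valP e').
by exists (exist (fun e => (e \in A) && (inc e \subset X)) e eAX).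
Qed.

Lemma sum_subhyper (R : realType) (f : edge H -> R) :
  \sum_(e : edge (subhyper X A)) f (subhyper_edge e) =
  \sum_(e | (e \in A) && (inc e \subset X)) f e.
Proof.
rewrite -(big_imset (h := @subhyper_edge H X A) f) /=; last by move=> x y _ _; exact: val_inj.
apply: eq_bigl => e; apply/imsetP/subhyper_edgeP => [[e' _ ->]|[e' ->]]; by exists e'.
Qed.

End Subhypergraph.

Section Components.
Variable K : hypergraph.
Implicit Types (X Y S : {set vert K}).

(** Quantifying over subsets of the ambient vertex set lets different [Y] be compared without
    subtypes. *)
Lemma component_connectedP Y :
  reflect (forall S, (forall e : edge K, inc e \subset Y ->
                        (inc e \subset S) || (inc e \subset ~: S)%SET) ->
             (Y \subset S) || (Y \subset ~: S)%SET)
    (hconnected (component Y)).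
Proof.
apply: (iffP (hconnectedP _)) => [conn S inS|conn S inS].
  have [e||] := conn [set v | val v \in S]%SET.
  - have := inS (component_edge e).
    have /andP[_ eY] := valP e; rewrite eY subhyper_edge_inc => /(_ isT).
    by case/orP => /fintype.subsetP sub; apply/orP; [left|right];
      apply/fintype.subsetP => v /(imset_f val)/sub; rewrite !inE.
  - move=> S0; apply/orP; right; apply/fintype.subsetP => v vY.
    have : exist (fun v => v \in Y) v vY \notin [set v : vert (component Y) | val v \in S]%SET.
      by rewrite S0 inE.
    by rewrite !inE.
  - move=> ST; apply/orP; left; apply/fintype.subsetP => v vY.
    have : exist (fun v => v \in Y) v vY \in [set v : vert (component Y) | val v \in S]%SET.
      by rewrite ST inE.
    by rewrite !inE.
have [e eY|/fintype.subsetP sub|/fintype.subsetP sub] := orP (conn (val @: S)%SET _).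
- have /subhyper_edgeP[e' ->] : (e \in [set: edge K]%SET) && (inc e \subset Y) by rewrite inE.
  rewrite subhyper_edge_inc; case/orP: (inS e') => sub; apply/orP; [left|right].
    exact: imsetS.
  apply/fintype.subsetP => _ /imsetP[v ve ->]; rewrite inE mem_imset; last exact: val_inj.
  by have := fintype.subsetP sub v ve; rewrite inE.
- right; apply/finset.setP => v; rewrite [RHS]inE.
  by have := sub _ (valP v); rewrite mem_imset //; exact: val_inj.
- left; apply/finset.setP => v; rewrite [RHS]inE.
  by have := sub _ (valP v); rewrite inE mem_imset => [/negPf|]; last exact: val_inj.
Qed.

Lemma component_connectedU X Y v : v \in X -> v \in Y ->
  hconnected (component X) -> hconnected (component Y) -> hconnected (component (X :|: Y)).
Proof.
move=> vX vY /component_connectedP cX /component_connectedP cY.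
apply/component_connectedP => S inS.
have sX : (X \subset S) || (X \subset ~: S)%SET.
  by apply: cX => e eX; apply: inS; apply: fintype.subset_trans eX (finset.subsetUl _ _).
have sY : (Y \subset S) || (Y \subset ~: S)%SET.
  by apply: cY => e eY; apply: inS; apply: fintype.subset_trans eY (finset.subsetUr _ _).
rewrite !finset.subUset.
case/orP: sX sY => sX /orP[] sY; rewrite sX sY ?orbT //.
  by have := fintype.subsetP sX _ vX; have := fintype.subsetP sY _ vY; rewrite inE => /negPf ->.
by have := fintype.subsetP sX _ vX; have := fintype.subsetP sY _ vY; rewrite inE => -> .
Qed.

Lemma component_connected_edge (e : edge K) : hconnected (component (inc e)).
Proof. by apply/component_connectedP => S; apply. Qed.

Lemma componentsP X : X \in components K ->
  [/\ X != finset.set0, hconnected (component X)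
    & forall Y v, hconnected (component Y) -> v \in X -> v \in Y -> Y \subset X].
Proof.
rewrite inE => /maxsetP[/= /andP[X0 cX] maxX]; split=> // Y v cY vX vY.
have <- : X :|: Y = X.
  apply: maxX; last exact: finset.subsetUl.
  rewrite (component_connectedU vX vY) // andbT.
  by apply/finset.set0Pn; exists v; rewrite inE vX.
exact: finset.subsetUr.
Qed.

Lemma components_edge X (e : edge K) v :
  X \in components K -> v \in inc e -> v \in X -> inc e \subset X.
Proof.
move=> /componentsP[_ _ maxX] ve vX.
exact: maxX (component_connected_edge e) vX ve.
Qed.

Lemma components_eq X Y v : X \in components K -> Y \in components K ->
  v \in X -> v \in Y -> X = Y.
Proof.
move=> /componentsP[_ cX maxX] /componentsP[_ cY maxY] vX vY.
by apply/eqP; rewrite finset.eqEsubset (maxX Y v) ?(maxY X v).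
Qed.

Lemma edge_in_component (e : edge K) :
  exists2 X, X \in components K & inc e \subset X.
Proof.
have [|X maxX eX] := @maxset_exists _ [pred Y : {set vert K} |
             (Y != finset.set0) && hconnected (component Y)] (inc e).
  by rewrite /= component_connected_edge andbT -card_gt0 ltnW // inc_gt1.
by exists X => //; rewrite inE.
Qed.

(** A hyperedge is connected, hence contained in some component, and distinct components are
    disjoint. *)
Lemma sum_components (R : realType) (f : edge K -> R) :
  \sum_(X in components K) \sum_(e : edge (component X)) f (component_edge e) = \sum_e f e.
Proof.
rewrite (eq_bigr (fun X => \sum_(e | inc e \subset X) f e)); last first.
  move=> X _; rewrite sum_subhyper; apply: eq_bigl => e; by rewrite inE.
rewrite (exchange_big_dep predT) //=; apply: eq_bigr => e _.
have [X XK eX] := edge_in_component e; have [v ve] := inc_neq0 e.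
rewrite (bigD1 X) /= ?XK ?eX // big_pred0 ?addr0 // => Y.
apply/negP => /andP[/andP[YK eY] /eqP]; apply.
by apply: (components_eq (v := v)) => //; [exact: (fintype.subsetP eY)|exact: (fintype.subsetP eX)].
Qed.

End Components.

(** * Splitting the energy between the components and the contraction *)

Lemma sum_induced (R : realType) (H : hypergraph) (F : {set edge H}) (f : edge H -> R) :
  \sum_(e : edge (induced F)) f (induced_edge e) = \sum_(e in F) f e.
Proof.
rewrite sum_subhyper; apply: eq_bigl => e.
by case: (boolP (e \in F)) => //= eF; apply: finset.bigcup_sup.
Qed.

Lemma induced_edgeP (H : hypergraph) (F : {set edge H}) e : e \in F ->
  exists e' : edge (induced F), e = induced_edge e'.
Proof.
move=> eF; apply/subhyper_edgeP; rewrite eF; exact: finset.bigcup_sup.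
Qed.

(** The first conclusion says that no hyperedge of [E_max] becomes a loop, which justifies
    identifying the hyperedges of [Q] with [E_max]. *)
Theorem theorem5p3 (R : realType) (H : hypergraph) (eta : edge H -> R)
    (H_connected : hconnected H) (H_gt1 : (1 < #|vert H|)%N)
    (eta_optimal : optimal_density (blocker (Omega R H)) eta)
    (eta_not_constant : ~ exists c : R, forall e : edge H, eta e = c) :
  let Emax := maximizers eta in
  let K := induced (~: Emax)%SET in
  let Q := contraction (~: Emax)%SET in
  [/\ contract_edges (~: Emax)%SET = Emax,
      Mod2 (blocker (Omega R H)) =
        (\sum_(X in components K) Mod2 (blocker (Omega R (component X)))
           + Mod2 (blocker (Omega R Q)))%E,
      forall X : {set vert K}, X \in components K ->
        optimal_density (blocker (Omega R (component X)))
          (fun e => eta (induced_edge (component_edge e)))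
    & optimal_density (blocker (Omega R Q))
        (fun e => eta (contracted_edge e))].
Proof.
move=> Emax K Q.
have [f0 f0max] := exists_maximizer eta H_connected H_gt1.
have contractE : contract_edges (~: Emax)%SET = Emax.
  by rewrite contract_edgesE (top_level H_connected H_gt1 eta_optimal f0max).1.
have optQ := quotient_optimal H_connected H_gt1 eta_optimal f0max.
have optK (X : {set vert K}) : X \in components K ->
    optimal_density (blocker (Omega R (component X)))
      (fun e => eta (induced_edge (component_edge e))).
  move=> XK; have [X0 cX maxX] := componentsP XK.
  have incE (e : edge (component X)) : inc (induced_edge (component_edge e)) =
      [set val (val u) | u in inc e]%SET.
    by rewrite !subhyper_edge_inc -imset_comp.
  apply: (@piece_optimal R H (component X) (fun u => val (val u))) => //.
  - by move=> e e' /val_inj/val_inj.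
  - by move=> u u' /val_inj/val_inj.
  (* Every vertex of [K] lies in a hyperedge, which is contained in its component, so the component
     has at least two vertices. *)
  - have [v vX] := finset.set0Pn _ X0.
    have /finset.bigcupP[e eF ve] := valP v.
    have [e' eE] := induced_edgeP eF.
    have ve' : v \in inc e' by rewrite inE; move: ve; rewrite eE.
    have eX := components_edge XK ve' vX.
    rewrite card_sig; apply: leq_trans (inc_gt1 e') _.
    exact: subset_leq_card.
  - move=> e; have /andP[+ _] := valP (component_edge e).
    by rewrite inE.
  - move=> f fmax; have fF : f \in (~: Emax)%SET by rewrite inE.
    have [f' ->] := induced_edgeP fF.
    (* A hyperedge of [K] that meets the component is contained in it. *)
    case: (boolP [disjoint inc f' & X]) => [dis|/fintype.pred0Pn[v /andP[vf vX]]]; [right|left].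
      rewrite -finset.setI_eq0; apply/eqP/finset.setP => w; rewrite finset.in_set0.
      apply/negP; rewrite inE => /andP[wf /imsetP[u _ wE]].
      have uf : val u \in inc f' by rewrite inE; move: wf; rewrite wE.
      by move/negP: (negbT (disjointFr dis uf)); apply; exact: (valP u).
    have fX := components_edge XK vf vX.
    have /subhyper_edgeP[e ->] : (f' \in [set: edge K]%SET) && (inc f' \subset X) by rewrite inE.
    by exists e.
split=> //.
have [_ <-] := eta_optimal; have [_ <-] := optQ.
(* By optimality each modulus is the energy of a restriction of [eta], so (i) reduces to
   partitioning a finite sum over hyperedges. *)
rewrite (eq_bigr (fun X : {set vert K} =>
    (\sum_(e : edge (component X)) eta (induced_edge (component_edge e)) ^+ 2)%:E)); last first.
  by move=> X /optK[_ <-].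
rewrite sumEFin -EFinD; congr EFin.
rewrite (sum_components (fun e : edge K => eta (induced_edge e) ^+ 2)).
rewrite (sum_induced (~: Emax)%SET (fun e => eta e ^+ 2)) /energy.
rewrite (sum_contracted (~: Emax)%SET predT (fun e => eta e ^+ 2)).
rewrite (bigID (mem Emax)) /= addrC; congr (_ + _); apply: eq_bigl => e; first by rewrite finset.in_setC.
by rewrite contractE andbT.
Qed.
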